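(* Let $S$ be a $\Gamma$-semiring which has a left unity and a right unity, and let $L$ be its left operator semiring. For a fuzzy subset $\sigma$ of $S$ let $\sigma^{+'}$ be the fuzzy subset of $L$ defined by $\sigma^{+'}(\sum_i[x_i,\alpha_i])=\inf_{a\in S}\sigma(\sum_i x_i\alpha_i a)$. Then the map $\sigma\mapsto\sigma^{+'}$ is an inclusion preserving bijection from the lattice of all fuzzy right ideals of $S$ to the lattice of all fuzzy right ideals of $L$. Likewise, the map $\sigma\mapsto\sigma^{+'}$ is an inclusion preserving bijection from the lattice of all fuzzy ideals of $S$ to the lattice of all fuzzy ideals of $L$.
   Context: $\Gamma$-semiring: $S$ and $\Gamma$ are (nonempty) additive commutative semigroups with a map $S\times\Gamma\times S\to S$, $(a,\alpha,b)\mapsto a\alpha b$, such that $a\alpha(b+c)=a\alpha b+a\alpha c$, $(a+b)\alpha c=a\alpha c+b\alpha c$, $a(\alpha+\beta)c=a\alpha c+a\beta c$, $a\alpha(b\beta c)=(a\alpha b)\beta c$ for all $a,b,c\in S$, $\alpha,\beta\in\Gamma$. No zero elements are assumed. Left operator semiring $L$: let $F$ be the free additive commutative semigroup generated by $S\times\Gamma$ (finite nonempty formal sums). The relation $\sum_i(x_i,\alpha_i)\,\rho\,\sum_j(y_j,\beta_j)$ iff $\sum_i x_i\alpha_i a=\sum_j y_j\beta_j a$ for all $a\in S$ is a congruence on $F$. The class of $\sum_i(x_i,\alpha_i)$ is written $\sum_i[x_i,\alpha_i]$. $L=F/\rho$ with the induced addition and the multiplication $(\sum_i[x_i,\alpha_i])(\sum_j[y_j,\beta_j])=\sum_{i,j}[x_i\alpha_i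 y_j,\beta_j]$ is a semiring. Unities: a left unity of $S$ is a finite sum $\sum_i[e_i,\delta_i]\in L$ with $\sum_i e_i\delta_i a=a$ for all $a\in S$. A right unity of $S$ is given by finitely many $\gamma_j\in\Gamma$, $f_j\in S$ with $\sum_j a\gamma_j f_j=a$ for all $a\in S$. A fuzzy subset of a set $X$ is a function $X\to[0,1]$; inclusion of fuzzy subsets is the pointwise order ($\sigma\le\tau$ iff $\sigma(x)\le\tau(x)$ for all $x$), and the lattices of fuzzy (right) ideals are ordered by it. Inclusion preserving means $\sigma\le\tau$ implies $\sigma^{+'}\le\tau^{+'}$. A fuzzy subset $\mu$ of $S$ is a fuzzy left (respectively right) ideal of $S$ if for all $a,b\in S$, $\alpha\in\Gamma$: $\mu(a+b)\ge\min(\mu(a),\mu(b))$ and $\mu(a\alpha b)\ge\mu(b)$ (respectively $\mu(a\alpha b)\ge\mu(a)$). A fuzzy subset $\mu$ of $L$ is a fuzzy left (respectively right) ideal of $L$ if for all $p,q\in L$: $\mu(p+q)\ge\min(\mu(p),\mu(q))$ and $\mu(pq)\ge\mu(q)$ (respectively $\mu(pq)\ge\mu(p)$). A fuzzy ideal (of $S$ or of $L$) is a fuzzy subset that is both a fuzzy left ideal and a fuzzy right ideal. *)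

(* Defs.v *)
From HB Require Import structures.
From mathcomp Require Import all_boot all_order all_algebra.
From mathcomp Require Import finmap multiset.
From mathcomp Require Import boolp classical_sets functions reals.
From mathcomp Require Import interval_inference.

Set Implicit Arguments.
Unset Strict Implicit.
Unset Printing Implicit Defensive.
Import Order.TTheory GRing.Theory Num.Theory.

Local Open Scope mset_scope.
Local Open Scope ring_scope.
Local Open Scope quotient_scope.
Local Open Scope classical_set_scope.

(* [addSemigroupType] is a commutative additive semigroup, without zero. *)
Record gammaSemiring (S G : addSemigroupType) := GammaSemiring {
  gmul :> S -> G -> S -> S;
  gS_inhabited : inhabited S;
  gG_inhabited : inhabited G;
  gmulDr : forall a al b c, gmul a al (b + c) = gmul a al b + gmul a al c;
  gmulDl : forall a al b c, gmul (a + b) al c = gmul a al c + gmul b al c;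
  gmulDm : forall a al be c, gmul a (al + be) c = gmul a al c + gmul a be c;
  gmulA : forall a al b be c, gmul a al (gmul b be c) = gmul (gmul a al b) be c
}.

(* The free commutative semigroup on K: nonempty finite multisets. *)
Definition formalSum (K : choiceType) := {m : {mset K} | m != mset0}.
HB.instance Definition _ (K : choiceType) := Choice.on (formalSum K).

Section FormalSum.
Variable K : choiceType.
Implicit Types (m n : {mset K}) (p q : formalSum K).

Lemma perm_msetD m n :
  perm_eq (enum_mset (msetD m n)) (enum_mset m ++ enum_mset n).
Proof.
by apply/allP => x _ /=; rewrite count_cat !count_mem_mset msetE2.
Qed.

Lemma mset_neq0P m : (m != mset0) = (0 < size (enum_mset m))%N.
Proof.
rewrite lt0n size_eq0; congr negb; apply/eqP/eqP => [->|h].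
  exact: enum_mset0.
by rewrite -[m]seq_mset_id h; apply/msetP => x; rewrite mset_seqE mset0E.
Qed.

Lemma formal_add_subproof p q : msetD (val p) (val q) != mset0.
Proof.
rewrite mset_neq0P (perm_size (perm_msetD _ _)) size_cat addn_gt0.
by rewrite -mset_neq0P (valP p).
Qed.

Definition formal_add p q : formalSum K := exist (fun m => m != mset0) _ (formal_add_subproof p q).

Fact formal_addC : commutative formal_add.
Proof. by move=> p q; apply: val_inj; exact: msetDC. Qed.

Fact formal_addA : associative formal_add.
Proof. by move=> p q r; apply: val_inj; exact: msetDA. Qed.

HB.instance Definition _ :=
  Algebra.isAddSemigroup.Build (formalSum K) formal_addC formal_addA.

Variable V : addSemigroupType.

Definition osum (I : Type) (s : seq I) (f : I -> V) : option V :=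
  \big[oAC (@Algebra.addrA V) (@Algebra.addrC V)/None]_(i <- s) Some (f i).

(* The sum of f over the terms of p, with multiplicity.  The default v0 is
   never reached since p is nonempty; it is only there because V has no 0. *)
Definition formal_eval (v0 : V) (f : K -> V) p : V :=
  odflt v0 (osum (enum_mset (val p)) f).

Lemma osum_cons (I : Type) i (s : seq I) (f : I -> V) :
  osum (i :: s) f = Some (oapp (fun v => f i + v) (f i) (osum s f)).
Proof. by rewrite /osum big_cons; case: (\big[_/_]_(_ <- s) _). Qed.

Lemma osum_cat (I : Type) (s t : seq I) (f : I -> V) :
  osum (s ++ t) f = oAC (@Algebra.addrA V) (@Algebra.addrC V) (osum s f) (osum t f).
Proof. exact: big_cat. Qed.

Lemma osum_perm (I : eqType) (s t : seq I) (f : I -> V) :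
  perm_eq s t -> osum s f = osum t f.
Proof. by move=> st; apply: perm_big. Qed.

Lemma formal_evalE v0 f p :
  osum (enum_mset (val p)) f = Some (formal_eval v0 f p).
Proof.
rewrite /formal_eval; have := valP p; rewrite mset_neq0P.
by case: (enum_mset _) => // k s _; rewrite osum_cons.
Qed.

Lemma formal_eval_default v0 v1 f p : formal_eval v0 f p = formal_eval v1 f p.
Proof. by apply: Some_inj; rewrite -!formal_evalE. Qed.

Lemma formal_evalD v0 f p q :
  formal_eval v0 f (p + q) = formal_eval v0 f p + formal_eval v0 f q.
Proof.
apply: Some_inj; rewrite -formal_evalE (osum_perm _ (perm_msetD _ _)).
by rewrite osum_cat !(formal_evalE v0).
Qed.

End FormalSum.

Lemma osum_morph (V W : addSemigroupType) (g : V -> W) (I : Type) (s : seq I)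
    (f : I -> V) :
  {morph g : x y / x + y} -> osum s (g \o f) = omap g (osum s f).
Proof.
move=> gD; elim: s => [|i s IH]; first by rewrite /osum !big_nil.
by rewrite !osum_cons IH /=; case: (osum s f) => //= v; rewrite gD.
Qed.

Section LeftOperatorSemiring.
Variables (S G : addSemigroupType) (M : gammaSemiring S G).
Implicit Types (p q : formalSum (S * G)%type) (a : S).

(* sum_i x_i alpha_i a *)
Definition formal_act p a : S := formal_eval a (fun k => M k.1 k.2 a) p.

Lemma formal_actD p q a : formal_act (p + q) a = formal_act p a + formal_act q a.
Proof. exact: formal_evalD. Qed.

Lemma formal_act_osum p a :
  osum (enum_mset (val p)) (fun k => M k.1 k.2 a) = Some (formal_act p a).
Proof. exact: formal_evalE. Qed.

Definition lop_equiv : rel (formalSum (S * G)%type) :=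
  fun p q => `[< forall a, formal_act p a = formal_act q a >].

Fact lop_equiv_refl : reflexive lop_equiv.
Proof. by move=> p; apply/asboolP. Qed.

Fact lop_equiv_sym : symmetric lop_equiv.
Proof. by move=> p q; apply/asboolP/asboolP => h a; rewrite h. Qed.

Fact lop_equiv_trans : transitive lop_equiv.
Proof. by move=> q p r /asboolP h /asboolP k; apply/asboolP => a; rewrite h. Qed.

Canonical lop_equiv_rel :=
  EquivRel lop_equiv lop_equiv_refl lop_equiv_sym lop_equiv_trans.

Definition lopSemiring := {eq_quot lop_equiv}.
HB.instance Definition _ := Choice.on lopSemiring.
HB.instance Definition _ := EqQuotient.on lopSemiring.

Definition lop_act (P : lopSemiring) (a : S) : S := formal_act (repr P) a.

Lemma lop_act_pi p a : lop_act (\pi_lopSemiring p) a = formal_act p a.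
Proof.
suff /asboolP h : lop_equiv (repr (\pi_lopSemiring p)) p by exact: h.
by apply/(eqquotP lopSemiring); rewrite reprK.
Qed.

Lemma lop_act_inj (P Q : lopSemiring) : lop_act P =1 lop_act Q -> P = Q.
Proof.
move=> h; rewrite -[P]reprK -[Q]reprK.
by apply/(eqquotP lopSemiring)/asboolP.
Qed.

Definition lop_add (P Q : lopSemiring) : lopSemiring :=
  \pi_lopSemiring (repr P + repr Q).

Lemma lop_add_act P Q a : lop_act (lop_add P Q) a = lop_act P a + lop_act Q a.
Proof. by rewrite lop_act_pi formal_actD. Qed.

Lemma lop_add_pi p q :
  lop_add (\pi_lopSemiring p) (\pi_lopSemiring q) = \pi_lopSemiring (p + q).
Proof.
by apply: lop_act_inj => a; rewrite lop_add_act !lop_act_pi formal_actD.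
Qed.

Fact lop_addC : commutative lop_add.
Proof. by move=> P Q; apply: lop_act_inj => a; rewrite !lop_add_act Algebra.addrC. Qed.

Fact lop_addA : associative lop_add.
Proof. by move=> P Q T; apply: lop_act_inj => a; rewrite !lop_add_act Algebra.addrA. Qed.

HB.instance Definition _ :=
  Algebra.isAddSemigroup.Build lopSemiring lop_addC lop_addA.

(* sum_(i,j) (x_i alpha_i y_j, beta_j) *)
Definition formal_mul_mset p q : {mset S * G} :=
  seq_mset [seq (M i.1 i.2 j.1, j.2) | i <- enum_mset (val p),
                                       j <- enum_mset (val q)].

Lemma formal_mul_subproof p q : formal_mul_mset p q != mset0.
Proof.
rewrite mset_neq0P (perm_size (perm_eq_seq_mset _)) size_allpairs muln_gt0.
by rewrite -!mset_neq0P (valP p) (valP q).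
Qed.

Definition formal_mul p q : formalSum (S * G)%type :=
  exist (fun m => m != mset0) _ (formal_mul_subproof p q).

Lemma formal_act_additive p : {morph formal_act p : a b / a + b}.
Proof.
move=> a b; apply: Some_inj; rewrite -formal_act_osum.
rewrite -[RHS](oACE (@Algebra.addrA S) (@Algebra.addrC S)) -!formal_act_osum.
rewrite /osum -big_split /=.
by apply: eq_bigr => k _; rewrite gmulDr oACE.
Qed.

Lemma formal_mul_act p q a :
  formal_act (formal_mul p q) a = formal_act p (formal_act q a).
Proof.
apply: Some_inj; rewrite -!formal_act_osum (osum_perm _ (perm_eq_seq_mset _)).
rewrite /osum big_allpairs_dep /=; apply: eq_bigr => i _.
have gD : {morph M i.1 i.2 : b c / b + c} by move=> b c; rewrite gmulDr.
have := osum_morph (enum_mset (val q)) (fun j => M j.1 j.2 a) gD.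
rewrite formal_act_osum /= => <-.
by apply: eq_bigr => j _ /=; rewrite gmulA.
Qed.

Definition lop_mul (P Q : lopSemiring) : lopSemiring :=
  \pi_lopSemiring (formal_mul (repr P) (repr Q)).

Lemma lop_mul_act P Q a : lop_act (lop_mul P Q) a = lop_act P (lop_act Q a).
Proof. by rewrite lop_act_pi formal_mul_act. Qed.

Lemma lop_mul_pi p q :
  lop_mul (\pi_lopSemiring p) (\pi_lopSemiring q)
  = \pi_lopSemiring (formal_mul p q).
Proof.
by apply: lop_act_inj => a; rewrite lop_mul_act !lop_act_pi formal_mul_act.
Qed.

Lemma lop_mulA : associative lop_mul.
Proof. by move=> P Q T; apply: lop_act_inj => a; rewrite !lop_mul_act. Qed.

Lemma lop_mulDl (P Q T : lopSemiring) :
  lop_mul (P + Q) T = lop_mul P T + lop_mul Q T.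
Proof.
by apply: lop_act_inj => a; rewrite !(lop_mul_act, lop_add_act).
Qed.

Lemma lop_mulDr (P Q T : lopSemiring) :
  lop_mul P (Q + T) = lop_mul P Q + lop_mul P T.
Proof.
apply: lop_act_inj => a; rewrite !(lop_mul_act, lop_add_act).
exact: formal_act_additive.
Qed.

Definition has_left_unity := exists e : lopSemiring, forall a, lop_act e a = a.

(* A right unity is a formal sum of pairs (gamma_j, f_j). *)
Definition has_right_unity := exists u : formalSum (G * S)%type,
  forall a, formal_eval a (fun k => M a k.1 k.2) u = a.

End LeftOperatorSemiring.

Arguments lop_mul {S G M}.

Definition fuzzy (R : realType) (X : Type) := X -> {i01 R}.

Section Inf01.
Variable R : realType.
Implicit Type A : set {i01 R}.

Fact inf01_ge0 A : 0 <= inf [set x%:num | x in A].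
Proof.
have [->|/set0P A0] := eqVneq A set0; first by rewrite image_set0 inf0.
apply: lb_le_inf; first by case: A0 => x Ax; exists x%:num; exists x.
by move=> _ [x _ <-].
Qed.

Fact inf01_le1 A : inf [set x%:num | x in A] <= 1.
Proof.
have [->|/set0P[x Ax]] := eqVneq A set0; first by rewrite image_set0 inf0.
apply: (@le_trans _ _ x%:num) => //; apply: ge_inf; last by exists x.
by exists 0 => _ [y _ <-].
Qed.

Definition inf01 A : {i01 R} := Itv01 (inf01_ge0 A) (inf01_le1 A).

End Inf01.

Section FuzzyIdeals.
Variables (R : realType) (S G : addSemigroupType) (M : gammaSemiring S G).

Definition fuzzy_left_ideal (mu : fuzzy R S) :=
  (forall a b, Order.min (mu a) (mu b) <= mu (a + b))
  /\ (forall a al b, mu b <= mu (M a al b)).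

Definition fuzzy_right_ideal (mu : fuzzy R S) :=
  (forall a b, Order.min (mu a) (mu b) <= mu (a + b))
  /\ (forall a al b, mu a <= mu (M a al b)).

Definition fuzzy_ideal (mu : fuzzy R S) :=
  fuzzy_left_ideal mu /\ fuzzy_right_ideal mu.

Definition lop_fuzzy_left_ideal (mu : fuzzy R (lopSemiring M)) :=
  (forall p q, Order.min (mu p) (mu q) <= mu (p + q))
  /\ (forall p q, mu q <= mu (lop_mul p q)).

Definition lop_fuzzy_right_ideal (mu : fuzzy R (lopSemiring M)) :=
  (forall p q, Order.min (mu p) (mu q) <= mu (p + q))
  /\ (forall p q, mu p <= mu (lop_mul p q)).

Definition lop_fuzzy_ideal (mu : fuzzy R (lopSemiring M)) :=
  lop_fuzzy_left_ideal mu /\ lop_fuzzy_right_ideal mu.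

(* sigma^{+'} *)
Definition plus_prime (sigma : fuzzy R S) : fuzzy R (lopSemiring M) :=
  fun p => inf01 [set sigma (lop_act p a) | a in [set: S]].

Lemma plus_prime_pi sigma (p : formalSum (S * G)%type) :
  plus_prime sigma (\pi_(lopSemiring M) p)
  = inf01 [set sigma (formal_act M p a) | a in [set: S]].
Proof.
by congr inf01; apply: eq_imagel => a _ /=; rewrite lop_act_pi.
Qed.

End FuzzyIdeals.

Definition inclusion_preserving_bijection (R : realType) (X Y : Type)
    (A : set (fuzzy R X)) (B : set (fuzzy R Y)) (f : fuzzy R X -> fuzzy R Y) :=
  set_bij A B f
  /\ (forall s t, A s -> A t ->
        (forall x, s x <= t x) -> forall y, f s y <= f t y).

(* Main.v *)
(* With [x,al] the class of a single pair, the inverse of [plus_prime] sends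
   [mu] to [x |-> inf_al mu [x,al]].  A right unity gives
   [x = sum_j x gamma_j f_j], hence [sigma x = inf_(al,a) sigma (x al a)] for a
   fuzzy right ideal [sigma] of S; a left unity gives
   [P = sum_i P [e_i,delta_i] = sum_i [P e_i, delta_i]], hence
   [mu P = inf_(a,al) mu (P [a,al])] for a fuzzy right ideal [mu] of L. *)
Require Import Defs.
From mathcomp Require Import all_boot all_order all_algebra.
From mathcomp Require Import finmap multiset.
From mathcomp Require Import boolp classical_sets reals.
From mathcomp Require Import interval_inference.

Set Implicit Arguments.
Unset Strict Implicit.
Unset Printing Implicit Defensive.
Import Order.TTheory.

Local Open Scope mset_scope.
Local Open Scope ring_scope.
Local Open Scope quotient_scope.
Local Open Scope classical_set_scope.

Section Inf01Theory.
Variable R : realType.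
Implicit Types (A : set {i01 R}) (c x : {i01 R}).

Lemma inf01_lb A x : A x -> inf01 A <= x.
Proof.
move=> Ax; rewrite -num_le /=; apply: ge_inf; last by exists x.
by exists 0 => _ [y _ <-].
Qed.

(** The infimum of the empty set is 0 here, so [A] must have an element for a positive [c] to be a
    lower bound of [inf01 A]. *)
Lemma inf01_glb A c : A !=set0 -> (forall x, A x -> c <= x) -> c <= inf01 A.
Proof.
move=> [x Ax] cA; rewrite -num_le /=; apply: lb_le_inf.
  by exists x%:num; exists x.
by move=> _ [y Ay <-]; rewrite num_le; exact: cA.
Qed.

Lemma inf01_image_lb (X : Type) (f : X -> {i01 R}) (a : X) :
  inf01 [set f b | b in [set: X]] <= f a.
Proof. by apply: inf01_lb; exists a. Qed.

Lemma inf01_image_glb (X : Type) (f : X -> {i01 R}) c :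
  inhabited X -> (forall a, c <= f a) -> c <= inf01 [set f b | b in [set: X]].
Proof.
move=> [a0] cf; apply: inf01_glb; first by exists (f a0), a0.
by move=> _ [a _ <-].
Qed.

End Inf01Theory.

Section FormalEval.
Variables (K : choiceType) (V : addSemigroupType).
Implicit Types (p : formalSum K) (f : K -> V).

(** Formal sums are nonempty, so the defaults [v0] and [w0] are never reached and need not
    correspond under [g]. *)
Lemma formal_eval_morph (W : addSemigroupType) (g : V -> W) v0 w0 f p :
  {morph g : x y / x + y} ->
  g (formal_eval v0 f p) = formal_eval w0 (g \o f) p.
Proof.
move=> gD; apply: Some_inj.
by rewrite -formal_evalE (osum_morph _ _ gD) (formal_evalE v0).
Qed.

Lemma eq_formal_eval v0 f g p :
  f =1 g -> formal_eval v0 f p = formal_eval v0 g p.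
Proof. by move=> fg; congr odflt; apply: eq_bigr => k _; rewrite fg. Qed.

(** Transparent, so that the underlying multiset computes to [[mset k]]. *)
Definition formal_gen (k : K) : formalSum K.
Proof.
by exists [mset k]; rewrite mset_neq0P enum_msetn.
Defined.

Lemma formal_eval_gen v0 f k : formal_eval v0 f (formal_gen k) = f k.
Proof.
apply: Some_inj; rewrite -formal_evalE enum_msetn.
by rewrite osum_cons /osum big_nil.
Qed.

Variables (R : realType) (mu : fuzzy R V).
Hypothesis muD : forall a b, Order.min (mu a) (mu b) <= mu (a + b).

(** The level set of all [v] with [c <= mu v] is closed under addition, hence under nonempty finite
    sums. *)
Lemma fuzzy_formal_eval c v0 f p :
  (forall k, c <= mu (f k)) -> c <= mu (formal_eval v0 f p).
Proof.
(* The induction runs over arbitrary lists; the default [true] settles the empty one, whose sum is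
   [None]. *)
move=> cf; suff: oapp (fun v => c <= mu v) true (osum (enum_mset (val p)) f).
  by rewrite (formal_evalE v0).
elim: (enum_mset _) => [|k s]; first by rewrite /osum big_nil.
rewrite osum_cons; case: (osum s f) => //= v cv.
by apply: le_trans (muD _ _); rewrite le_min cf.
Qed.

End FormalEval.

Section PlusPrime.
Variables (R : realType) (S G : addSemigroupType) (M : gammaSemiring S G).
Local Notation L := (lopSemiring M).
Implicit Types (P Q : L) (sigma : fuzzy R S) (mu : fuzzy R L).

Lemma lop_act_additive P : {morph lop_act P : a b / a + b}.
Proof. exact: formal_act_additive. Qed.

Lemma lop_act_gmul P x al a : lop_act P (M x al a) = M (lop_act P x) al a.
Proof.
rewrite [in RHS]/lop_act /formal_act.
rewrite (@formal_eval_morph _ _ _ (fun y => M y al a) _ (M x al a)) => [|y z].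
  by apply: eq_formal_eval => k /=; rewrite gmulA.
exact: gmulDl.
Qed.

Definition lop_gen (x : S) (al : G) : L := \pi_L (formal_gen (x, al)).

Lemma lop_gen_act x al a : lop_act (lop_gen x al) a = M x al a.
Proof. by rewrite lop_act_pi /formal_act formal_eval_gen. Qed.

Lemma lop_genD x y al : lop_gen (x + y) al = lop_gen x al + lop_gen y al.
Proof. by apply: lop_act_inj => a; rewrite lop_add_act !lop_gen_act gmulDl. Qed.

Lemma lop_mul_gen P x al : lop_mul P (lop_gen x al) = lop_gen (lop_act P x) al.
Proof.
by apply: lop_act_inj => a; rewrite lop_mul_act !lop_gen_act lop_act_gmul.
Qed.

Lemma lop_gen_gmul x al y be :
  lop_gen (M x al y) be = lop_mul (lop_gen x al) (lop_gen y be).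
Proof. by rewrite lop_mul_gen lop_gen_act. Qed.

(** Equality in [L] is tested on actions: at [a] the left side is the sum of the
    [(P e_i) delta_i a], that is [P (e a) = P a]. *)
Lemma lop_left_unity_sum (e P : L) : (forall a, lop_act e a = a) ->
  formal_eval P (fun k => lop_gen (lop_act P k.1) k.2) (repr e) = P.
Proof.
move=> e1; apply: lop_act_inj => a.
rewrite (@formal_eval_morph _ _ _ (fun Q => lop_act Q a) _ (lop_act P a));
  last by move=> *; exact: lop_add_act.
(* Write [a] as [e a] and expand only this inner action, so that the additive map [P] distributes
   over its terms. *)
rewrite -[in RHS](e1 a) [in RHS]/lop_act -/(lop_act P _).
rewrite (formal_eval_morph _ (lop_act P a) _ _ (lop_act_additive P)).
by apply: eq_formal_eval => k /=; rewrite lop_gen_act lop_act_gmul.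
Qed.

Definition lop_restrict mu : fuzzy R S :=
  fun x => inf01 [set mu (lop_gen x al) | al in [set: G]].

Lemma plus_prime_mono sigma tau : (forall x, sigma x <= tau x) ->
  forall P, plus_prime (M := M) sigma P <= plus_prime tau P.
Proof.
move=> st P; apply: inf01_image_glb => [|a]; first exact: gS_inhabited M.
exact: le_trans (inf01_image_lb _ a) (st _).
Qed.

Lemma plus_prime_right_ideal sigma : fuzzy_right_ideal M sigma ->
  lop_fuzzy_right_ideal (plus_prime (M := M) sigma).
Proof.
move=> [sD sM]; split=> P Q;
  (apply: inf01_image_glb => [|a]; first exact: gS_inhabited M).
  rewrite lop_add_act; apply: le_trans (sD _ _).
  by rewrite le_min !ge_min !inf01_image_lb orbT.
(* Since [(P Q) a = P (Q a)], this value belongs to the family whose infimum is taken at [P]. *)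
by rewrite lop_mul_act; exact: (inf01_image_lb (fun b => sigma (lop_act P b))).
Qed.

Lemma plus_prime_left_ideal sigma : fuzzy_ideal M sigma ->
  lop_fuzzy_left_ideal (plus_prime (M := M) sigma).
Proof.
move=> [[sD sM] /plus_prime_right_ideal[pD _]]; split=> // P Q.
apply: inf01_image_glb => [|a]; first exact: gS_inhabited M.
rewrite lop_mul_act; apply: le_trans (inf01_image_lb _ a) _.
(* [P (Q a)] is a sum of terms [x_i alpha_i (Q a)], each of value at least [sigma (Q a)] by left
   absorption. *)
by apply: fuzzy_formal_eval => // k.
Qed.

Lemma lop_restrict_additive mu :
  (forall P Q, Order.min (mu P) (mu Q) <= mu (P + Q)) ->
  forall a b, Order.min (lop_restrict mu a) (lop_restrict mu b)
              <= lop_restrict mu (a + b).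
Proof.
move=> mD a b; apply: inf01_image_glb => [|al]; first exact: gG_inhabited M.
rewrite lop_genD; apply: le_trans (mD _ _).
by rewrite le_min !ge_min !inf01_image_lb orbT.
Qed.

(** Since [[a al b,be] = [a,al][b,be]], right absorption in [L] bounds each value of the infimum
    below by [mu [a,al]]. *)
Lemma lop_restrict_right_ideal mu : lop_fuzzy_right_ideal mu ->
  fuzzy_right_ideal M (lop_restrict mu).
Proof.
move=> [mD mM]; split=> [|a al b]; first exact: lop_restrict_additive.
apply: inf01_image_glb => [|be]; first exact: gG_inhabited M.
by rewrite lop_gen_gmul; apply: le_trans (mM _ _); exact: inf01_image_lb.
Qed.

(** The same factorisation applies, with the bound now given by the second factor [[b,be]]. *)
Lemma lop_restrict_left_ideal mu : lop_fuzzy_left_ideal mu ->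
  fuzzy_left_ideal M (lop_restrict mu).
Proof.
move=> [mD mM]; split=> [|a al b]; first exact: lop_restrict_additive.
apply: inf01_image_glb => [|be]; first exact: gG_inhabited M.
by rewrite lop_gen_gmul; apply: le_trans (mM _ _); exact: inf01_image_lb.
Qed.

Lemma plus_primeK sigma : has_right_unity M -> fuzzy_right_ideal M sigma ->
  lop_restrict (plus_prime sigma) = sigma.
Proof.
move=> [u u1] [sD sM]; apply: funext => x; apply/le_anti/andP; split.
  (* With [x] written as the sum of the [x gamma_j f_j], it suffices that each [sigma (x al f)] is a
     value of the double infimum. *)
  rewrite -[in leRHS](u1 x); apply: fuzzy_formal_eval => // -[al f] /=.
  apply: le_trans (inf01_image_lb _ al) _.
  by apply: le_trans (inf01_image_lb _ f) _; rewrite lop_gen_act.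
(* Conversely, right absorption bounds every [sigma (x al a)] below by [sigma x]. *)
apply: inf01_image_glb => [|al]; first exact: gG_inhabited M.
apply: inf01_image_glb => [|a]; first exact: gS_inhabited M.
by rewrite lop_gen_act.
Qed.

Lemma lop_restrictK mu : has_left_unity M -> lop_fuzzy_right_ideal mu ->
  plus_prime (lop_restrict mu) = mu.
Proof.
move=> [e e1] [mD mM]; apply: funext => P; apply/le_anti/andP; split.
  (* The left unity expands [P] into terms [[P x,al]], whose values under [mu] all occur in the
     double infimum. *)
  rewrite -[in leRHS](lop_left_unity_sum P e1).
  apply: fuzzy_formal_eval => // -[x al] /=.
  apply: le_trans (inf01_image_lb _ x) _.
  exact: (inf01_image_lb (fun be => mu (lop_gen (lop_act P x) be))).
apply: inf01_image_glb => [|a]; first exact: gS_inhabited M.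
apply: inf01_image_glb => [|al]; first exact: gG_inhabited M.
(* [[P a,al]] is the product [P [a,al]], so right absorption in [L] applies. *)
by rewrite -lop_mul_gen.
Qed.

End PlusPrime.

Theorem theorem3p3 (R : realType) (S G : addSemigroupType)
    (M : gammaSemiring S G) :
  has_left_unity M -> has_right_unity M ->
  inclusion_preserving_bijection
    (fuzzy_right_ideal M : set (fuzzy R S))
    (@lop_fuzzy_right_ideal R S G M)
    (@plus_prime R S G M)
  /\
  inclusion_preserving_bijection
    (fuzzy_ideal M : set (fuzzy R S))
    (@lop_fuzzy_ideal R S G M)
    (@plus_prime R S G M).
Proof.
move=> lu ru; split; split; try by move=> s t _ _; exact: plus_prime_mono.
- split=> [s|s t|mu mu_ideal].
  + exact: plus_prime_right_ideal.
  + rewrite !inE => sI tI st.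
    by rewrite -(plus_primeK ru sI) st plus_primeK.
  + exists (lop_restrict mu); first exact: lop_restrict_right_ideal.
    exact: lop_restrictK.
(* Fuzzy ideals are fuzzy right ideals, so both cancellation lemmas still apply; what is new is that
   both maps preserve left absorption. *)
- split=> [s sI|s t|mu [muL muR]].
  + by split; [exact: plus_prime_left_ideal|apply: plus_prime_right_ideal sI.2].
  + rewrite !inE => -[_ sI] [_ tI] st.
    by rewrite -(plus_primeK ru sI) st plus_primeK.
  + exists (lop_restrict mu); last exact: lop_restrictK.
    by split; [exact: lop_restrict_left_ideal|exact: lop_restrict_right_ideal].
Qed.
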